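(* Suppose $\mathcal{D}(EM_v)$ is dense in $L^2(\mu)$ and let $k\ge1$ be a fixed integer. For $n\ge1$ put $$A^0_n(|E(v)|^2)=\sum_{0\le i\le n}(-1)^i\binom{n}{i}|E(v)|^{2i},\qquad A^1_n(|E(v)|^2)=\sum_{1\le i\le n}(-1)^i\binom{n}{i}|E(v)|^{2(i-1)}.$$ Then: (i) if $EM_v$ is $k$-hyperexpansive, then $A^0_n(|E(v)|^2)\le0$ for $n=1,2,\dots,k$; (ii) if $1+E(|v|^2)A^1_n(|E(v)|^2)\le0$ and $|E(vf)|^2=E(|v|^2)E(|f|^2)$ for all $f\in\mathcal{D}((EM_v)^n)$ and $n=1,2,\dots,k$, then $EM_v$ is $k$-hyperexpansive; (iii) if $EM_v$ is completely hyperexpansive, then (a) the sequence $\{|E(v)(t)|^{2n}\}_{n=0}^\infty$ is completely alternating for almost every $t\in\Omega$, and (b) $A^0_n(|E(v)|^2)\le0$ for all $n\ge1$; (iv) if $1+E(|v|^2)A^1_n(|E(v)|^2)\le0$ and $|E(vf)|^2=E(|v|^2)E(|f|^2)$ for all $f\in\mathcal{D}((EM_v)^n)$ and all $n\ge1$, then $EM_v$ is completely hyperexpansive.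
   Context: $(\Omega,\Sigma,\mu)$ is a $\sigma$-finite measure space and $\mathcal{A}\subseteq\Sigma$ is a $\sigma$-subalgebra such that $(\Omega,\mathcal{A},\mu)$ is also $\sigma$-finite. $L^2(\Sigma)=L^2(\mu)=L^2(\Omega,\Sigma,\mu)$ (complex-valued functions). Equalities and inequalities between functions hold $\mu$-a.e. $E=E^{\mathcal{A}}$ is the conditional expectation with respect to $\mathcal{A}$: for $f\ge0$ $\Sigma$-measurable (then $E(f)$ may take values in $[0,\infty]$) or $f\in L^2(\Sigma)$, $E(f)$ is the unique $\mathcal{A}$-measurable function with $\int_A f\,d\mu=\int_A E(f)\,d\mu$ for all $A\in\mathcal{A}$ for which the integrals exist. For a general complex-valued $\Sigma$-measurable $f$, $E(f)$ is understood to be defined when $E(|f|)<\infty$ a.e. (by linearity from nonnegative functions). The function $v:\Omega\to\mathbb{C}$ is $\Sigma$-measurable and conditionable, i.e. $E(v)$ is defined (in the paper $v=u(E(|w|^2))^{1/2}$ arises from a weighted conditional type operator $M_wEM_u$; taking $w=1$ gives arbitrary $v=u$). The operator $EM_v$ in $L^2(\mu)$ is $f\mapsto E(vf)$ with domain $\mathcal{D}(EM_v)=\{f\in L^2(\mu): E(vf)\in L^2(\mu)\}$ (which includes the requirement that $E(vf)$ is defined). For an operator $T$ in a Hilbert space and $n\ge1$, put $\Theta_{T,n}(f)=\sum_{0\le i\le n}(-1)^i\binom{n}{i}\|T^i f\|^2$ for $f\in\mathcal{D}(T^n)$. $T$ is $k$-hyperexpansive ($k\ge1$) if $\Theta_{T,n}(f)\le0$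 for all $f\in\mathcal{D}(T^n)$ and $n=1,\dots,k$; $T$ is completely hyperexpansive if $\Theta_{T,n}(f)\le0$ for all $f\in\mathcal{D}(T^n)$ and all $n\ge1$. A real sequence $\{\phi(n)\}_{n\ge0}$ is completely alternating if $\sum_{0\le i\le n}(-1)^i\binom{n}{i}\phi(m+i)\le0$ for all $m\ge0$ and $n\ge1$. *)

(* Defs.v *)
From HB Require Import structures.
From mathcomp Require Import all_boot all_order all_algebra.
From mathcomp Require Import all_classical all_reals all_analysis.
From mathcomp Require Import measurable_realfun complex.

Set Implicit Arguments.
Unset Strict Implicit.
Unset Printing Implicit Defensive.

Import Order.TTheory GRing.Theory Num.Theory.
Import numFieldNormedType.Exports.

Local Open Scope classical_set_scope.
Local Open Scope ring_scope.

(* The real-valued modulus; [`|z|] on [R[i]] lives in [R[i]] itself. *)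
Definition modc (R : realType) (z : R[i]) : R := ComplexField.Normc.normc z.

Definition measurable_complex d (T : measurableType d) (R : realType)
    (f : T -> R[i]) : Prop :=
  measurable_fun [set: T] (fun x => complex.Re (f x)) /\
  measurable_fun [set: T] (fun x => complex.Im (f x)).

(* Elements of L^2 are represented by functions, without passing to classes
   modulo almost everywhere equality. *)
Definition L2 d (T : measurableType d) (R : realType)
    (mu : {measure set T -> \bar R}) : set (T -> R[i]) :=
  [set f | measurable_complex f /\
           (\int[mu]_x (modc (f x) ^+ 2)%:E < +oo)%E].

Definition L2norm d (T : measurableType d) (R : realType)
    (mu : {measure set T -> \bar R}) (f : T -> R[i]) : R :=
  Num.sqrt (fine (\int[mu]_x (modc (f x) ^+ 2)%:E)%E).

Definition dense_in_L2 d (T : measurableType d) (R : realType)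
    (mu : {measure set T -> \bar R}) (D : set (T -> R[i])) : Prop :=
  forall g, L2 mu g -> forall e : R, 0 < e ->
    exists2 f, D f & L2norm mu (fun x => f x - g x) < e.

(** * Conditional expectation with respect to a sub-sigma-algebra [A] *)

(* [g] is a version of the conditional expectation of [f >= 0]; since [A] is
   a sigma-algebra, the measurable sets of [g_sigma_algebraType A] are the
   elements of [A]. *)
Definition is_cond_exp d (T : measurableType d) (R : realType)
    (mu : {measure set T -> \bar R}) (A : set (set T)) (f g : T -> \bar R)
    : Prop :=
  [/\ measurable_fun [set: g_sigma_algebraType A]
        (g : g_sigma_algebraType A -> \bar R),
      (forall x, (0 <= g x)%E) &
      forall B, A B -> (\int[mu]_(x in B) f x = \int[mu]_(x in B) g x)%E].

(* A version exists and is unique almost everywhere when [f] is nonnegative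
   and measurable and [mu] is sigma-finite on [A].  Functions [f] that are
   equal almost everywhere have the same set of versions, hence the same
   chosen one. *)
Definition cond_exp d (T : measurableType d) (R : realType)
    (mu : {measure set T -> \bar R}) (A : set (set T)) (f : T -> \bar R)
    : T -> \bar R :=
  xget (cst 0%E) [set g | is_cond_exp mu A f g].

Definition cond_exp_sqmod d (T : measurableType d) (R : realType)
    (mu : {measure set T -> \bar R}) (A : set (set T))
    (f : T -> R[i]) : T -> \bar R :=
  cond_exp mu A (fun x => (modc (f x) ^+ 2)%:E).

Definition conditionable d (T : measurableType d) (R : realType)
    (mu : {measure set T -> \bar R}) (A : set (set T)) (f : T -> R[i]) : Prop :=
  measurable_complex f /\
  {ae mu, forall x, (cond_exp mu A (fun y => (modc (f y))%:E) x < +oo)%E}.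

Definition cond_exp_real d (T : measurableType d) (R : realType)
    (mu : {measure set T -> \bar R}) (A : set (set T)) (f : T -> R) : T -> R :=
  fun x => fine (cond_exp mu A (fun y => (Num.max (f y) 0)%:E) x)
         - fine (cond_exp mu A (fun y => (Num.max (- f y) 0)%:E) x).

(* Only meaningful for conditionable [f]. *)
Definition cond_expC d (T : measurableType d) (R : realType)
    (mu : {measure set T -> \bar R}) (A : set (set T)) (f : T -> R[i])
    : T -> R[i] :=
  fun x => Complex (cond_exp_real mu A (fun y => complex.Re (f y)) x)
                   (cond_exp_real mu A (fun y => complex.Im (f y)) x).

(** * Operators in L^2 *)

(* Values of [op_fun] outside of [op_dom] are irrelevant. *)
Record operator (T : Type) (R : realType) := Operator {
  op_dom : set (T -> R[i]);
  op_fun : (T -> R[i]) -> T -> R[i] }.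

Fixpoint op_dom_pow d (T : measurableType d) (R : realType)
    (mu : {measure set T -> \bar R}) (S : operator T R) (n : nat)
    : set (T -> R[i]) :=
  if n is m.+1 then [set f | op_dom S f /\ op_dom_pow mu S m (op_fun S f)]
  else L2 mu.

Definition Theta d (T : measurableType d) (R : realType)
    (mu : {measure set T -> \bar R}) (S : operator T R) (n : nat)
    (f : T -> R[i]) : R :=
  \sum_(0 <= i < n.+1)
    (-1) ^+ i * ('C(n, i))%:R * L2norm mu (iter i (op_fun S) f) ^+ 2.

Definition k_hyperexpansive d (T : measurableType d) (R : realType)
    (mu : {measure set T -> \bar R}) (k : nat) (S : operator T R) : Prop :=
  forall n, (1 <= n <= k)%N ->
  forall f, op_dom_pow mu S n f -> Theta mu S n f <= 0.

Definition completely_hyperexpansive d (T : measurableType d) (R : realType)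
    (mu : {measure set T -> \bar R}) (S : operator T R) : Prop :=
  forall n, (1 <= n)%N ->
  forall f, op_dom_pow mu S n f -> Theta mu S n f <= 0.

(* The operator [f |-> E (v f)]. *)
Definition EMop d (T : measurableType d) (R : realType)
    (mu : {measure set T -> \bar R}) (A : set (set T)) (v : T -> R[i])
    : operator T R :=
  let EMv f := cond_expC mu A (fun x => v x * f x) in
  {| op_dom := [set f | [/\ L2 mu f,
                            conditionable mu A (fun x => v x * f x) &
                            L2 mu (EMv f)]];
     op_fun := EMv |}.

Definition completely_alternating (R : realType) (phi : nat -> R) : Prop :=
  forall m n, (1 <= n)%N ->
    \sum_(0 <= i < n.+1) (-1) ^+ i * ('C(n, i))%:R * phi (m + i)%N <= 0.

Definition A0 (R : realType) (n : nat) (x : R) : R :=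
  \sum_(0 <= i < n.+1) (-1) ^+ i * ('C(n, i))%:R * x ^+ i.

Definition A1 (R : realType) (n : nat) (x : R) : R :=
  \sum_(1 <= i < n.+1) (-1) ^+ i * ('C(n, i))%:R * x ^+ i.-1.

(* Main.v *)
Require Import Defs.
From HB Require Import structures.
From mathcomp Require Import all_boot all_order all_algebra.
From mathcomp Require Import all_classical all_reals all_analysis.
From mathcomp Require Import measurable_realfun complex ring.
Import Order.TTheory GRing.Theory Num.Theory.
Import numFieldNormedType.Exports.
Local Open Scope classical_set_scope.
Local Open Scope ring_scope.

Set Implicit Arguments.
Unset Strict Implicit.
Unset Printing Implicit Defensive.

(** Everything rests on the pull-out property: for an [A]-measurable [g],
    [E (v g) = E v * g] almost everywhere ([cond_expC_mul]).  Since values of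
    [f |-> E (v f)] are [A]-measurable, iterating the operator from an
    [A]-measurable function only multiplies by powers of [E v]
    ([iter_EMop]), so that the squared norms in [Theta] are integrals of powers
    of [|E v|^2] against a fixed weight.

    - If [f] is the indicator of an [A]-measurable set [B] of finite measure
      on which [|E v|] is bounded, then [f] is in the domain of all powers and
      [Theta] is the integral over [B] of [A0 n (|E v|^2)].  Taking for [B]
      bounded pieces of the set where this function is positive shows that the
      set is null ([hyperexpansive_A0]).

    - For any [f] in the domain of the [n]-th power, the first application of
      the operator already yields an [A]-measurable function, so [Theta] is the
      integral of [E (|f|^2) + |E (v f)|^2 * A1 n (|E v|^2)].  Under the
      equality case of the Cauchy-Schwarz inequality this integrand is
      [E (|f|^2) * (1 + E (|v|^2) * A1 n (|E v|^2))], which is nonpositive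
      ([Theta_EMop_le0]).

    Completely alternating powers come from the factorization
    [x^(2m) * A0 n (x^2)] of the differences.

    Conditional expectations of functions that need not be integrable are
    needed throughout, because only [E |v| < +oo] almost everywhere is assumed.
    They are built here from the Radon-Nikodym theorem on [A], and the pull-out
    property is obtained first for nonnegative functions by approximation with
    simple functions, then for real and complex ones by linearity. *)

(** * The modulus of complex-valued functions *)

Section complex.
Context (R : realType).
Implicit Types z w : R[i].

Lemma modcM z w : modc (z * w) = modc z * modc w.
Proof. exact: ComplexField.Normc.normcM. Qed.

Lemma modcX z n : modc (z ^+ n) = modc z ^+ n.
Proof.
elim: n => [|n IH]; first exact: ComplexField.Normc.normc1.
by rewrite !exprS modcM IH.
Qed.

Lemma modc_ge0 z : 0 <= modc z.
Proof. by case: z => a b; exact: sqrtr_ge0. Qed.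

Lemma modc_sqrE z : modc z ^+ 2 = complex.Re z ^+ 2 + complex.Im z ^+ 2.
Proof. by case: z => a b; rewrite /modc/= sqr_sqrtr// addr_ge0// sqr_ge0. Qed.

Lemma ler_Re_modc z : `|complex.Re z| <= modc z.
Proof.
rewrite -(ler_pXn2r (ltn0Sn 1)) ?nnegrE ?modc_ge0// real_normK ?num_real//.
by rewrite modc_sqrE lerDl sqr_ge0.
Qed.

Lemma ler_Im_modc z : `|complex.Im z| <= modc z.
Proof.
rewrite -(ler_pXn2r (ltn0Sn 1)) ?nnegrE ?modc_ge0// real_normK ?num_real//.
by rewrite modc_sqrE lerDr sqr_ge0.
Qed.

Lemma ReM z w : complex.Re (z * w) =
  complex.Re z * complex.Re w - complex.Im z * complex.Im w.
Proof. by case: z w => a b [c e]. Qed.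

Lemma ImM z w : complex.Im (z * w) =
  complex.Re z * complex.Im w + complex.Im z * complex.Re w.
Proof. by case: z w => a b [c e]. Qed.

End complex.

Section measurable_complex.
Context (d : measure_display) (T : measurableType d) (R : realType).
Implicit Types f g : T -> R[i].

Lemma measurable_modc f : measurable_complex f ->
  measurable_fun [set: T] (fun x => modc (f x)).
Proof.
move=> [mRe mIm].
rewrite (_ : (fun _ => _) =
  (fun x => Num.sqrt (complex.Re (f x) ^+ 2 + complex.Im (f x) ^+ 2))); last first.
  by apply/funext => x; rewrite /modc; case: (f x).
have msqrt : measurable_fun [set: R] (Num.sqrt : R -> R).
  by apply: continuous_measurable_fun; exact: sqrt_continuous.
apply: (measurableT_comp msqrt).
by apply: measurable_funD; exact: measurable_funX.
Qed.

Lemma measurable_complexM f g : measurable_complex f -> measurable_complex g ->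
  measurable_complex (fun x => f x * g x).
Proof.
move=> [mfr mfi] [mgr mgi]; split.
  under eq_fun do rewrite ReM.
  by apply: measurable_funB; exact: measurable_funM.
under eq_fun do rewrite ImM.
by apply: measurable_funD; exact: measurable_funM.
Qed.

End measurable_complex.

(** * Norms of iterates as integrals *)

Section L2.
Context (d : measure_display) (T : measurableType d) (R : realType).
Context (mu : {measure set T -> \bar R}).

Lemma integral_le0_ae (F : T -> \bar R) : measurable_fun [set: T] F ->
  {ae mu, forall x, F x <= 0}%E -> (\int[mu]_x F x <= 0)%E.
Proof.
move=> mF F0; rewrite integralE.
rewrite (_ : \int[mu]_x F^\+ x = 0)%E.
  by rewrite sub0e oppe_le0 integral_ge0.
rewrite -(integral0 mu [set: T]); apply: ge0_ae_eq_integral => //.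
  exact: measurable_funepos.
by apply: filterS F0 => x Fx0 _; rewrite funeposE; exact/max_r.
Qed.

Lemma L2norm_sqr (f : T -> R[i]) :
  L2norm mu f ^+ 2 = fine (\int[mu]_x (modc (f x) ^+ 2)%:E)%E.
Proof.
by rewrite sqr_sqrtr// fine_ge0// integral_ge0// => x _; rewrite lee_fin sqr_ge0.
Qed.

Lemma measurable_modc_sqr (f : T -> R[i]) : measurable_complex f ->
  measurable_fun [set: T] (fun x => (modc (f x) ^+ 2)%:E).
Proof. by move=> mf; apply/measurable_EFinP/measurable_funX/measurable_modc. Qed.

Variable S : operator T R.

Lemma op_dom_pow_L2 n f i : op_dom_pow mu S n f -> (forall f, op_dom S f -> L2 mu f) ->
  (i <= n)%N -> L2 mu (iter i (op_fun S) f).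
Proof.
move=> + domL2; elim: n f i => [|n IH] f [|i]//=.
- by move=> [/domL2].
- by move=> [_ /IH Sf] le_in; rewrite -iterS iterSr; exact: Sf.
Qed.

(** The functions [u i] stand for [|S^i f|^2] up to equality of integrals, which
    leaves room for replacing [|f|^2] by its conditional expectation. *)
Lemma Theta_integral n f (u : nat -> T -> R) :
  (forall i, (i <= n)%N -> mu.-integrable [set: T] (EFin \o u i)) ->
  (forall i, (i <= n)%N -> \int[mu]_x (modc (iter i (op_fun S) f x) ^+ 2)%:E =
                           \int[mu]_x (u i x)%:E)%E ->
  (Theta mu S n f)%:E =
  (\int[mu]_x (\sum_(0 <= i < n.+1) (-1) ^+ i * ('C(n, i))%:R * u i x)%:E)%E.
Proof.
move=> intu uE; rewrite /Theta big_mkord.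
transitivity (\int[mu]_x
    (\sum_(i < n.+1) ((-1) ^+ i * ('C(n, i))%:R)%:E * (u i x)%:E))%E; last first.
  by apply: eq_integral => x _; rewrite big_mkord -sumEFin.
rewrite integral_sum//; last first.
  by move=> i; apply: integrableZl => //; apply: intu; rewrite -ltnS.
rewrite -sumEFin; apply: eq_bigr => i _.
have le_in : (i <= n)%N by rewrite -ltnS.
rewrite integralZl//; last exact: intu.
rewrite EFinM L2norm_sqr uE// fineK//.
by apply: integrable_fin_num => //; exact: intu.
Qed.

End L2.

Lemma completely_alternating_powers (R : realType) (x : R) : 0 <= x ->
  (forall n, (1 <= n)%N -> A0 n (x ^+ 2) <= 0) ->
  completely_alternating (fun n => x ^+ (2 * n)).
Proof.
move=> x0 A0x m n n1.
rewrite (_ : \sum_(0 <= i < n.+1) _ = x ^+ (2 * m) * A0 n (x ^+ 2)).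
  by rewrite mulr_ge0_le0 ?exprn_ge0 ?A0x.
rewrite /A0 mulr_sumr; apply: eq_bigr => i _.
by rewrite mulnDr exprD [x ^+ (2 * i)]exprM; ring.
Qed.

(** * The restriction of the measure to the subalgebra *)

Section subalgebra.
Context (d : measure_display) (T : measurableType d) (R : realType).
Context (mu : {measure set T -> \bar R}) (A : set (set T)).
Hypothesis A_sigma : sigma_algebra [set: T] A.
Hypothesis A_sub : forall B, A B -> measurable B.
Hypothesis muA_sfinite : sigma_finite [set: g_sigma_algebraType A] mu.

Local Notation TA := (g_sigma_algebraType A).

Lemma measurable_subalgebraE (B : set TA) : measurable B = A B.
Proof. by rewrite -[LHS]/(<<s A >> B) sigma_algebra_id. Qed.

(** Measurability with respect to [A] of a function on [T]; the carriers of [T]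
    and [TA] are the same type. *)
Definition Ameasurable d' (Y : measurableType d') (f : T -> Y) :=
  measurable_fun [set: TA] (f : TA -> Y).

Lemma measurable_id_subalgebra : measurable_fun [set: T] (id : T -> TA).
Proof.
by move=> _ B; rewrite measurable_subalgebraE setTI => /A_sub.
Qed.

Lemma Ameasurable_measurable d' (Y : measurableType d') (f : T -> Y) :
  Ameasurable f -> measurable_fun [set: T] f.
Proof.
by move=> mf; exact: (measurableT_comp mf measurable_id_subalgebra).
Qed.

(** The proofs are arguments so that the measure instances below, which need
    them, can be inferred from the function alone. *)
Definition subalgebra_measure of (sigma_algebra [set: T] A) &
    (forall B, A B -> measurable B) & (sigma_finite [set: TA] mu) :=
  fun B : set TA => mu B.

Local Notation muA := (subalgebra_measure A_sigma A_sub muA_sfinite).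

Let muA0 : muA set0 = 0%E. Proof. exact: measure0. Qed.

Let muA_ge0 B : (0 <= muA B)%E. Proof. exact: measure_ge0. Qed.

Let muA_sigma_additive : semi_sigma_additive muA.
Proof.
move=> F mF tF mUF; apply: measure_semi_sigma_additive => //.
- by move=> n; apply: A_sub; rewrite -measurable_subalgebraE.
- by apply: A_sub; rewrite -measurable_subalgebraE.
Qed.

HB.instance Definition _ := isMeasure.Build _ _ _ muA
  muA0 muA_ge0 muA_sigma_additive.

HB.instance Definition _ := @Measure_isSigmaFinite.Build _ _ _ muA muA_sfinite.

(** [muA] is the image of [mu] by the identity from [T] to [TA]. *)
Lemma integral_subalgebra (B : set T) (g : T -> \bar R) :
  A B -> Ameasurable g -> (forall x, 0 <= g x)%E ->
  (\int[muA]_(x in B) (g : TA -> \bar R) x = \int[mu]_(x in B) g x)%E.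
Proof.
move=> AB mg g0.
have mB : measurable (B : set TA) by rewrite measurable_subalgebraE.
have := @ge0_integral_pushforward _ _ T TA R (id : T -> TA)
   measurable_id_subalgebra mu B g mB (measurable_funTS mg) _.
move=> <- //.
Qed.

(** * Existence of conditional expectations *)

Section density.
Context (f : T -> \bar R).
Hypothesis mf : measurable_fun [set: T] f.
Hypothesis f0 : forall x, (0 <= f x)%E.
Hypothesis foo : (\int[mu]_x f x < +oo)%E.

Definition density_measure of measurable_fun [set: T] f &
    (forall x, 0 <= f x)%E & (\int[mu]_x f x < +oo)%E :=
  fun B : set TA => (\int[mu]_(x in B) f x)%E.

Local Notation nu := (density_measure mf f0 foo).

Let nu0 : nu set0 = 0%E. Proof. exact: integral_set0. Qed.

Let nu_ge0 B : (0 <= nu B)%E.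
Proof. by apply: integral_ge0 => x _; exact: f0. Qed.

Let nu_sigma_additive : semi_sigma_additive nu.
Proof.
move=> F mF tF mUF; have := @semi_sigma_additive_nng_induced _ T R mu f mf f0 F.
apply => //.
- by move=> n; apply: A_sub; rewrite -measurable_subalgebraE.
- by apply: A_sub; rewrite -measurable_subalgebraE.
Qed.

HB.instance Definition _ := isMeasure.Build _ _ _ nu nu0 nu_ge0
  nu_sigma_additive.

Let nu_fin : fin_num_fun nu.
Proof.
move=> B mB; rewrite ge0_fin_numE// (le_lt_trans _ foo)//.
by apply: ge0_subset_integral => //; apply: A_sub; rewrite -measurable_subalgebraE.
Qed.

HB.instance Definition _ := Measure_isFinite.Build _ _ _ nu nu_fin.

(** The Radon-Nikodym derivative of [B |-> \int_B f] with respect to the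
    restriction of [mu] to [A]. *)
Lemma is_cond_exp_integrable : exists g, is_cond_exp mu A f g.
Proof.
have : nu `<< muA.
  apply/null_content_dominatesP => B mB muB0.
  apply: null_set_integral => //; last exact: measurable_funTS.
  by apply: A_sub; rewrite -measurable_subalgebraE.
move=> /radon_nikodym_sigma_finite[g [g0 _ /measurable_int mg gE]].
exists g; split => // B AB.
rewrite -(integral_subalgebra AB mg g0).
by apply: gE; rewrite measurable_subalgebraE.
Qed.

End density.

Lemma is_cond_exp_nneseries (f g : (T -> \bar R)^nat) :
  (forall n, measurable_fun [set: T] (f n)) -> (forall n x, 0 <= f n x)%E ->
  (forall n, is_cond_exp mu A (f n) (g n)) ->
  is_cond_exp mu A (fun x => \sum_(n <oo) f n x)%E
                   (fun x => \sum_(n <oo) g n x)%E.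
Proof.
move=> mf f0 fg; have mg n : Ameasurable (g n) by case: (fg n).
have g0 n x : (0 <= g n x)%E by case: (fg n).
split.
- exact: (@ge0_emeasurable_sum _ TA R setT g xpredT (fun n x _ _ => g0 n x)
    (fun n _ => mg n)).
- by move=> x; exact: nneseries_ge0.
- move=> B AB; have mB := A_sub AB.
  rewrite !integral_nneseries//; last 2 first.
  + by move=> n; exact/measurable_funTS/Ameasurable_measurable.
  + by move=> n; exact: measurable_funTS.
  by apply: eq_eseriesr => n _; case: (fg n) => _ _ ->.
Qed.

Lemma sigma_finite_nondecreasing : exists F : (set T)^nat,
  [/\ forall n, A (F n), forall n, (mu (F n) < +oo)%E,
      nondecreasing_seq F & \bigcup_n F n = [set: T]].
Proof.
have [F TF mF] := muA_sfinite.
have AF n : A (F n) by rewrite -measurable_subalgebraE; case: (mF n).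
have mbF n : measurable (\big[setU/set0]_(i < n.+1) F i : set TA).
  by apply: bigsetU_measurable => i _; case: (mF i).
exists (fun n => \big[setU/set0]_(i < n.+1) F i); split.
- by move=> n; rewrite -measurable_subalgebraE.
- move=> n; have := @content_subadditive _ _ _ muA (\big[setU/set0]_(i < n.+1) F i) F n.+1.
  move=> /(_ (fun i _ => (mF i).1) (mbF n) (@subset_refl _ _)).
  move=> /le_lt_trans; apply; apply: lte_sum_pinfty => i _; exact: (mF i).2.
- by move=> m n mn; apply/subsetPset/subset_bigsetU.
- by rewrite bigcup_bigsetU_bigcup.
Qed.

Import HBNNSimple.

(** The measure [B |-> \int_B f] need not be sigma-finite on [A], so the
    Radon-Nikodym theorem does not apply to it directly.  Instead [f] is written
    as a countable sum of nonnegative integrable functions, the increments of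
    simple approximations of [f] cut off to sets of finite measure; the
    conditional expectations of the terms are then summed. *)
Lemma is_cond_exp_exists (f : T -> \bar R) :
  measurable_fun [set: T] f -> (forall x, 0 <= f x)%E ->
  exists g, is_cond_exp mu A f g.
Proof.
move=> mf f0; have [F [AF Foo ndF FT]] := sigma_finite_nondecreasing.
pose h := nnsfun_approx measurableT mf.
(* The sequence starts with 0 so that its increments sum up to its limit. *)
pose t n x : R := if n is m.+1 then h m x * \1_(F m) x else 0.
have mF n : measurable (F n) by exact: A_sub.
have mt n : measurable_fun setT (t n).
  case: n => [|n]; first exact: measurable_cst.
  by apply: measurable_funM => //; exact: measurable_indic.
have ndt n x : t n x <= t n.+1 x.
  case: n => [|n] /=; first by rewrite mulr_ge0.
  rewrite ler_pM//; last 1 first.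
  - have /subsetPset FF := ndF _ _ (leqnSn n).
    by rewrite !indicE ler_nat; case: (boolP (x \in F n)) => // /set_mem /FF/mem_set ->.
  - by have /lefP := nd_nnsfun_approx measurableT mf (leqnSn n); exact.
have t0 n x : 0 <= t n x by elim: n => // n /le_trans; apply.
have tf x : (t n x)%:E @[n --> \oo] --> f x.
  rewrite -(cvg_shiftS (fun n => (t n x)%:E)) /=.
  have : (h n x)%:E @[n --> \oo] --> f x by exact: cvg_nnsfun_approx.
  apply: cvg_trans; apply: near_eq_cvg.
  have [N _ FNx] : (\bigcup_n F n) x by rewrite FT.
  near=> n; rewrite indicE mem_set ?mulr1//.
  have Nn : (N <= n)%N by near: n; exact: nbhs_infty_ge.
  by have /subsetPset := ndF _ _ Nn; exact.
pose g n x := (t n.+1 x - t n x)%:E.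
have mg n : measurable_fun [set: T] (g n).
  exact/measurable_EFinP/measurable_funB.
have g0 n x : (0 <= g n x)%E by rewrite lee_fin subr_ge0.
have goo n : (\int[mu]_x g n x < +oo)%E.
  apply: (@le_lt_trans _ _ (\int[mu]_x (t n.+1 x)%:E)%E).
    apply: ge0_le_integral => //.
    - exact/measurable_EFinP.
    - by move=> x _; rewrite lee_fin lerBlDr lerDl.
  rewrite (_ : (\int[mu]_x _)%E = (\int[mu]_(x in F n) (h n x)%:E)%E); last first.
    rewrite [RHS]integral_mkcond; apply: eq_integral => x _.
    by rewrite epatch_indic /= EFinM.
  have : mu.-integrable (F n) (EFin \o h n).
    apply: measurable_bounded_integrable => //.
    - exact: measurable_funTS.
    - have [M [Mreal hM]] := simple_bounded (h n).
      by exists M; split => // y My x _; exact: hM.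
  by move=> /integrable_lty; apply.
have [e ge] := choice (fun n => is_cond_exp_integrable (mg n) (g0 n) (goo n)).
exists (fun x => \sum_(n <oo) e n x)%E.
rewrite (_ : f = fun x => \sum_(n <oo) g n x)%E; first exact: is_cond_exp_nneseries.
apply/funext => x; apply/esym/cvg_lim => //.
rewrite (_ : (fun n => _) = (fun n => (t n x)%:E)) //.
by apply/funext => n; rewrite sumEFin telescope_sumr// subr0.
Unshelve. all: by end_near. Qed.

Lemma cond_expP (f : T -> \bar R) :
  measurable_fun [set: T] f -> (forall x, 0 <= f x)%E ->
  is_cond_exp mu A f (cond_exp mu A f).
Proof.
by move=> mf f0; have [g fg] := is_cond_exp_exists mf f0; exact: (xgetI _ fg).
Qed.

(** * Comparison, additivity and the pull-out property *)

(** On a set of [A] of finite measure where [g2] is bounded and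
    [g2 + e <= g1], the integral of [g2] is finite, so the inequality of
    integrals forces the set to be null.  Countably many such sets cover
    [g2 < g1]. *)
Lemma ae_le_of_integral_le (g1 g2 : T -> \bar R) :
  Ameasurable g1 -> Ameasurable g2 -> (forall x, 0 <= g1 x)%E ->
  (forall x, 0 <= g2 x)%E ->
  (forall B, A B -> \int[mu]_(x in B) g1 x <= \int[mu]_(x in B) g2 x)%E ->
  {ae mu, forall x, g1 x <= g2 x}%E.
Proof.
move=> mg1 mg2 g10 g20 g12.
have [F [AF Foo ndF FT]] := sigma_finite_nondecreasing.
pose e n : R := n.+1%:R^-1.
pose B n := F n `&` ([set x | (g2 x <= n%:R%:E)%E] `&`
                     [set x | (g2 x + (e n)%:E <= g1 x)%E]).
have AB n : A (B n).
  rewrite -measurable_subalgebraE; apply: measurableI.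
    by rewrite measurable_subalgebraE.
  apply: measurableI; rewrite -[X in measurable X]setTI.
    by apply: (@measurable_lee _ TA) => //; exact: measurable_cst.
  by apply: (@measurable_lee _ TA) => //; apply: emeasurable_funD => //.
have mB n : measurable (B n) by exact: A_sub.
have mg1T := Ameasurable_measurable mg1.
have mg2T := Ameasurable_measurable mg2.
have B0 n : mu (B n) = 0%E.
  have muBoo : (mu (B n) < +oo)%E.
    apply: le_lt_trans (Foo n); apply: le_measure; rewrite ?inE//; last exact: subIsetl.
    exact: A_sub.
  have int2 : (\int[mu]_(x in B n) g2 x < +oo)%E.
    apply: (@le_lt_trans _ _ (\int[mu]_(x in B n) cst n%:R%:E x)%E).
      apply: ge0_le_integral => //; first exact: measurable_funTS.
      by move=> x [_ []].
    by rewrite integral_cst// lte_mul_pinfty// lee_fin.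
  have : (\int[mu]_(x in B n) g2 x + (e n)%:E * mu (B n) <=
          \int[mu]_(x in B n) g2 x)%E.
    apply: le_trans (g12 _ (AB n)).
    rewrite -integral_cst// -ge0_integralD//; last 2 first.
    - exact: measurable_funTS.
    - by move=> x _; rewrite lee_fin invr_ge0.
    apply: ge0_le_integral => //.
    - by move=> x _; rewrite adde_ge0// lee_fin invr_ge0.
    - by apply: emeasurable_funD => //; exact: measurable_funTS.
    - exact: measurable_funTS.
    - by move=> x [_ []].
  rewrite -[leRHS]adde0 leeD2lE; last first.
    by rewrite ge0_fin_numE// integral_ge0.
  by rewrite pmule_rle0 ?lte_fin ?invr_gt0// measure_le0 => /eqP.
have : mu.-negligible (\bigcup_n B n).
  by apply: negligible_bigcup => n; exists (B n); split.
apply: negligibleS => x /= /negP; rewrite -ltNge => g21.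
have [r g2r] : exists r, g2 x = r%:E.
  by exists (fine (g2 x)); rewrite fineK// ge0_fin_numE// (lt_le_trans g21)// leey.
have [s s0 sP] : exists2 s : R, 0 < s & (g2 x + s%:E <= g1 x)%E.
  move: g21; rewrite g2r; case: (g1 x) => [q||] //=.
    by rewrite lte_fin => rq; exists (q - r); rewrite ?subr_gt0// -EFinD lee_fin subrKC.
  by exists 1; rewrite // leey.
have [N _ FNx] : (\bigcup_n F n) x by rewrite FT.
near \oo => n; exists n => //; split.
  have Nn : (N <= n)%N by near: n; exact: nbhs_infty_ge.
  by have /subsetPset := ndF _ _ Nn; exact.
split => /=.
  by rewrite g2r lee_fin; near: n; exact: nbhs_infty_ger.
apply: le_trans sP; rewrite leeD2l// lee_fin ltW// /e.
by near: n; exact: (near_infty_natSinv_lt (PosNum s0)).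
Unshelve. all: by end_near. Qed.

Lemma is_cond_exp_unique (f g1 g2 : T -> \bar R) :
  is_cond_exp mu A f g1 -> is_cond_exp mu A f g2 ->
  {ae mu, forall x, g1 x = g2 x}.
Proof.
move=> [mg1 g10 fg1] [mg2 g20 fg2].
have g12 B : A B -> (\int[mu]_(x in B) g1 x = \int[mu]_(x in B) g2 x)%E.
  by move=> AB; rewrite -fg1// -fg2.
have le12 := ae_le_of_integral_le mg1 mg2 g10 g20.
have le21 := ae_le_of_integral_le mg2 mg1 g20 g10.
have {}le12 : {ae mu, forall x, g1 x <= g2 x}%E.
  by apply: le12 => B AB; rewrite g12.
have {}le21 : {ae mu, forall x, g2 x <= g1 x}%E.
  by apply: le21 => B AB; rewrite g12.
by apply: filterS2 le12 le21 => x le1 le2; apply/eqP; rewrite eq_le le1.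
Qed.

Lemma is_cond_expD (f1 f2 g1 g2 : T -> \bar R) :
  measurable_fun [set: T] f1 -> measurable_fun [set: T] f2 ->
  (forall x, 0 <= f1 x)%E -> (forall x, 0 <= f2 x)%E ->
  is_cond_exp mu A f1 g1 -> is_cond_exp mu A f2 g2 ->
  is_cond_exp mu A (f1 \+ f2)%E (g1 \+ g2)%E.
Proof.
move=> mf1 mf2 f10 f20 [mg1 g10 fg1] [mg2 g20 fg2]; split.
- exact: emeasurable_funD.
- by move=> x; rewrite adde_ge0.
- move=> B AB; have mB := A_sub AB.
  have mg1T := Ameasurable_measurable mg1.
  have mg2T := Ameasurable_measurable mg2.
  by rewrite !ge0_integralD//; try exact: measurable_funTS; rewrite fg1// fg2.
Qed.

(** The right-hand side only involves integrals of [F] over sets of [A]. *)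
Lemma integral_nnsfun_mul (k : {nnsfun TA >-> R}) (F : T -> R) (B : set T) :
  A B -> measurable_fun [set: T] F -> (forall x, 0 <= F x) ->
  (\int[mu]_(x in B) (k x * F x)%:E =
   \sum_(y \in range k) y%:E * \int[mu]_(x in B `&` k @^-1` [set y]) (F x)%:E)%E.
Proof.
move=> AB mF F0; have mB := A_sub AB.
have mk y : measurable (k @^-1` [set y] : set T).
  by apply: A_sub; rewrite -measurable_subalgebraE.
have k0 y : y \in range k -> 0 <= y by rewrite inE => -[x _ <-].
transitivity (\int[mu]_(x in B) (\sum_(y \in range k)
    y%:E * ((\1_(k @^-1` [set y]) x) * F x)%:E))%E.
  apply: eq_integral => x _; rewrite [k x]fimfunE.
  rewrite EFinM -fsumEFin// ge0_mule_fsuml; last first.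
    by move=> y; exact: nnfun_muleindic_ge0.
  by apply: eq_fsbigr => y _; rewrite EFinM EFinM muleA.
have mind y : measurable_fun [set: T] (fun x => ((\1_(k @^-1` [set y]) x) * F x)%:E).
  by apply/measurable_EFinP/measurable_funM => //; exact: measurable_indic.
have ind0 y x : (0 <= ((\1_(k @^-1` [set y]) x) * F x)%:E)%E.
  by rewrite lee_fin mulr_ge0.
rewrite ge0_integral_fsum//; last 2 first.
- by move=> y; apply: measurable_funeM; exact: measurable_funTS.
- move=> y x _; have [yk|] := boolP (y \in range k).
    by apply: mule_ge0; rewrite ?ind0// lee_fin k0.
  rewrite notin_setE => yk; rewrite indicE memNset ?mul0r ?mule0// => kxy.
  by apply: yk; exists x.
apply: eq_fsbigr => y /k0 y0; rewrite ge0_integralZl//; last exact: measurable_funTS.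
congr (_ * _)%E; rewrite integral_mkcondr; apply: eq_integral => x _.
by rewrite epatch_indic /= EFinM muleC.
Qed.

(** By [integral_nnsfun_mul] the two integrals agree when [h] is a simple
    function on [A]; monotone convergence gives the general case. *)
Lemma is_cond_expM (h f g : T -> R) :
  Ameasurable h -> (forall x, 0 <= h x) ->
  measurable_fun [set: T] f -> (forall x, 0 <= f x) ->
  is_cond_exp mu A (EFin \o f) (EFin \o g) ->
  is_cond_exp mu A (fun x => (h x * f x)%:E) (fun x => (h x * g x)%:E).
Proof.
move=> mh h0 mf f0 [/measurable_EFinP mg g0 fg].
have mhT := Ameasurable_measurable mh.
have mgT := Ameasurable_measurable mg.
split.
- by apply/measurable_EFinP/measurable_funM.
- by move=> x; rewrite lee_fin mulr_ge0// -lee_fin; exact: g0.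
move=> B AB; have mB := A_sub AB.
have mh' : measurable_fun [set: TA] (EFin \o h) by exact/measurable_EFinP.
pose k := nnsfun_approx measurableT mh'.
have lim_k (F : T -> R) : measurable_fun [set: T] F -> (forall x, 0 <= F x) ->
    (\int[mu]_(x in B) (h x * F x)%:E =
     limn (fun n => \int[mu]_(x in B) (k n x * F x)%:E))%E.
  move=> mF F0.
  have cvgk x : (k n x * F x)%:E @[n --> \oo] --> (h x * F x)%:E.
    under eq_fun do rewrite EFinM.
    rewrite EFinM; apply: cvgeZr => //.
    apply: (cvg_nnsfun_approx measurableT mh') => // y _; exact: h0.
  have mk n : measurable_fun [set: T] (k n).
    by apply: Ameasurable_measurable; exact: measurable_funP.
  under eq_integral => x _ do rewrite -(cvg_lim _ (cvgk x))//.
  rewrite monotone_convergence//.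
  - by move=> n; apply/measurable_EFinP/measurable_funTS/measurable_funM.
  - by move=> n x _; rewrite lee_fin mulr_ge0.
  - move=> x _ a b ab; rewrite lee_fin ler_wpM2r//.
    by have /lefP := nd_nnsfun_approx measurableT mh' ab; exact.
rewrite !lim_k//; congr (limn _); apply/funext => n.
rewrite !integral_nnsfun_mul//; apply: eq_fsbigr => y _; congr (_ * _)%E.
rewrite fg// -measurable_subalgebraE; apply: measurableI => //.
by rewrite measurable_subalgebraE.
Qed.

Lemma is_cond_exp_le (f1 f2 g1 g2 : T -> \bar R) :
  measurable_fun [set: T] f1 -> measurable_fun [set: T] f2 ->
  (forall x, 0 <= f1 x)%E -> (forall x, f1 x <= f2 x)%E ->
  is_cond_exp mu A f1 g1 -> is_cond_exp mu A f2 g2 ->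
  {ae mu, forall x, g1 x <= g2 x}%E.
Proof.
move=> mf1 mf2 f10 f12 [mg1 g10 fg1] [mg2 g20 fg2].
apply: (ae_le_of_integral_le mg1 mg2 g10 g20) => B AB.
rewrite -fg1// -fg2//; apply: ge0_le_integral => //; try exact: measurable_funTS.
exact: A_sub.
Qed.

(** A conditional expectation that is finite almost everywhere has a version
    that is finite everywhere. *)
Lemma is_cond_exp_fine (f : T -> \bar R) :
  measurable_fun [set: T] f -> (forall x, 0 <= f x)%E ->
  {ae mu, forall x, cond_exp mu A f x < +oo}%E ->
  is_cond_exp mu A f (EFin \o (fun x => fine (cond_exp mu A f x))).
Proof.
move=> mf f0 foo; have [mg g0 fg] := cond_expP mf f0.
have mg' : Ameasurable (EFin \o (fun x => fine (cond_exp mu A f x))).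
  apply/measurable_EFinP; exact: measurableT_comp.
split => // [x|B AB]; first by rewrite lee_fin fine_ge0.
rewrite fg//; apply: ge0_ae_eq_integral => //.
- exact: A_sub.
- exact/measurable_funTS/Ameasurable_measurable.
- exact/measurable_funTS/Ameasurable_measurable.
- by move=> x _; rewrite lee_fin fine_ge0.
- by apply: filterS foo => x goo _ /=; rewrite fineK// ge0_fin_numE.
Qed.

(** * Conditional expectation of real functions *)

(** [e] is a conditional expectation of [w], witnessed by an arbitrary
    decomposition of [w] as a difference of nonnegative functions.  Unlike the
    decomposition into positive and negative parts that defines [cond_exp_real],
    such decompositions are stable under sums and under products with
    [A]-measurable functions, so linearity can be proved pointwise. *)
Definition has_cond_exp (w e : T -> R) := exists p q P Q : T -> R,
  [/\ measurable_fun [set: T] p, measurable_fun [set: T] q,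
      (forall x, 0 <= p x) /\ (forall x, 0 <= q x),
      is_cond_exp mu A (EFin \o p) (EFin \o P) /\
      is_cond_exp mu A (EFin \o q) (EFin \o Q) &
      forall x, w x = p x - q x /\ e x = P x - Q x].

Lemma has_cond_exp_opp w e : has_cond_exp w e -> has_cond_exp (\- w) (\- e).
Proof.
move=> [p [q [P [Q [mp mq [p0 q0] [pP qQ] we]]]]].
by exists q, p, Q, P; split => // x /=; have [-> ->] := we x; rewrite !opprB.
Qed.

Lemma has_cond_exp_add w1 e1 w2 e2 : has_cond_exp w1 e1 -> has_cond_exp w2 e2 ->
  has_cond_exp (w1 \+ w2) (e1 \+ e2).
Proof.
move=> [p1 [q1 [P1 [Q1 [mp1 mq1 [p10 q10] [pP1 qQ1] we1]]]]].
move=> [p2 [q2 [P2 [Q2 [mp2 mq2 [p20 q20] [pP2 qQ2] we2]]]]].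
exists (p1 \+ p2), (q1 \+ q2), (P1 \+ P2), (Q1 \+ Q2); split.
- exact: measurable_funD.
- exact: measurable_funD.
- by split => x; rewrite addr_ge0.
- have EFinP (s : T -> R) : measurable_fun [set: T] s ->
    measurable_fun [set: T] (EFin \o s) by move=> ?; exact/measurable_EFinP.
  split.
  + exact: (is_cond_expD (EFinP _ mp1) (EFinP _ mp2) p10 p20 pP1 pP2).
  + exact: (is_cond_expD (EFinP _ mq1) (EFinP _ mq2) q10 q20 qQ1 qQ2).
- by move=> x /=; have [-> ->] := we1 x; have [-> ->] := we2 x; split; ring.
Qed.

Lemma has_cond_exp_ge0M (h w e : T -> R) : Ameasurable h -> (forall x, 0 <= h x) ->
  has_cond_exp w e -> has_cond_exp (h \* w) (h \* e).
Proof.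
move=> mh h0 [p [q [P [Q [mp mq [p0 q0] [pP qQ] we]]]]].
have mhT := Ameasurable_measurable mh.
exists (h \* p), (h \* q), (h \* P), (h \* Q); split.
- exact: measurable_funM.
- exact: measurable_funM.
- by split => x; rewrite mulr_ge0.
- by split; exact: is_cond_expM.
- by move=> x /=; have [-> ->] := we x; rewrite !mulrBr.
Qed.

Lemma has_cond_expM (h w e : T -> R) : Ameasurable h ->
  has_cond_exp w e -> has_cond_exp (h \* w) (h \* e).
Proof.
move=> mh we.
have mhp : Ameasurable (fun x => Num.max (h x) 0) by exact: measurable_maxr.
have mhn : Ameasurable (fun x => Num.max (- h x) 0).
  by apply: measurable_maxr => //; exact: measurableT_comp.
have hE x : h x = Num.max (h x) 0 - Num.max (- h x) 0.
  have [h0|h0] := leP 0 (h x).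
    by rewrite max_r ?subr0// oppr_le0.
  by rewrite max_l ?oppr_ge0 ?ltW// sub0r opprK.
have hp0 x : 0 <= Num.max (h x) 0 by rewrite le_max lexx orbT.
have hn0 x : 0 <= Num.max (- h x) 0 by rewrite le_max lexx orbT.
have := has_cond_exp_add (has_cond_exp_ge0M mhp hp0 we)
  (has_cond_exp_opp (has_cond_exp_ge0M mhn hn0 we)).
by congr has_cond_exp; apply/funext => x /=; rewrite [in RHS]hE mulrBl.
Qed.

(** Independence of the decomposition: if [w = p - q], then [w^+ + q = w^- + p],
    and additivity and uniqueness transfer this identity to the conditional
    expectations. *)
Lemma has_cond_expE (w e : T -> R) : measurable_fun [set: T] w -> has_cond_exp w e ->
  {ae mu, forall x, cond_exp_real mu A w x = e x}.
Proof.
move=> mw [p [q [P [Q [mp mq [p0 q0] [pP qQ] we]]]]].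
have mwp : measurable_fun [set: T] (fun x => (Num.max (w x) 0)%:E).
  by apply/measurable_EFinP/measurable_maxr.
have mwn : measurable_fun [set: T] (fun x => (Num.max (- w x) 0)%:E).
  by apply/measurable_EFinP/measurable_maxr => //; exact: measurableT_comp.
have wp0 x : (0 <= (Num.max (w x) 0)%:E)%E by rewrite lee_fin le_max lexx orbT.
have wn0 x : (0 <= (Num.max (- w x) 0)%:E)%E by rewrite lee_fin le_max lexx orbT.
have Ewp := cond_expP mwp wp0; have Ewn := cond_expP mwn wn0.
have mp' : measurable_fun [set: T] (EFin \o p) by exact/measurable_EFinP.
have mq' : measurable_fun [set: T] (EFin \o q) by exact/measurable_EFinP.
have lep : {ae mu, forall x,
    cond_exp mu A (fun x => (Num.max (w x) 0)%:E) x <= (P x)%:E}%E.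
  apply: is_cond_exp_le Ewp pP => // x; have [-> _] := we x.
  by rewrite lee_fin ge_max p0 lerBlDr lerDl q0.
have leq : {ae mu, forall x,
    cond_exp mu A (fun x => (Num.max (- w x) 0)%:E) x <= (Q x)%:E}%E.
  apply: is_cond_exp_le Ewn qQ => // x; have [-> _] := we x.
  by rewrite lee_fin ge_max q0 opprB lerBlDr lerDl p0.
have E1 := is_cond_expD mwp mq' wp0 (fun x => q0 x) Ewp qQ.
have E2 := is_cond_expD mwn mp' wn0 (fun x => p0 x) Ewn pP.
have pq : ((fun x => (Num.max (w x) 0)%:E) \+ (EFin \o q) =
           (fun x => (Num.max (- w x) 0)%:E) \+ (EFin \o p))%E.
  apply/funext => x /=; rewrite -!EFinD; congr EFin.
  have [-> _] := we x; have [pq|pq] := leP (q x) (p x).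
    by rewrite max_l ?subr_ge0// max_r ?oppr_le0 ?subr_ge0// subrK add0r.
  by rewrite max_r ?subr_le0 ?ltW// max_l ?oppr_ge0 ?subr_le0 ?ltW// opprB subrK add0r.
rewrite pq in E1.
have := is_cond_exp_unique E1 E2.
have [_ gp0 _] := Ewp; have [_ gn0 _] := Ewn.
apply: filterS3 lep leq => x /= lep leq.
rewrite /cond_exp_real; have [_ ->] := we x.
move: (gp0 x) (gn0 x) lep leq.
case: (cond_exp _ _ _ x) => [a||]//; case: (cond_exp _ _ _ x) => [b||]// _ _ _ _ /=.
rewrite -!EFinD => -[/eqP]; rewrite -subr_eq => /eqP <-; ring.
Qed.

(** The bound by [f] makes the conditional expectations of the positive and
    negative parts of [w] finite almost everywhere. *)
Lemma has_cond_exp_real (w : T -> R) (f : T -> R) : measurable_fun [set: T] w ->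
  measurable_fun [set: T] f -> (forall x, `|w x| <= f x) ->
  {ae mu, forall x, cond_exp mu A (EFin \o f) x < +oo}%E ->
  has_cond_exp w (cond_exp_real mu A w).
Proof.
move=> mw mf wf foo.
have f0 x : 0 <= f x by exact: le_trans (wf x).
have fin (s : T -> R) : measurable_fun [set: T] s -> (forall x, 0 <= s x) ->
    (forall x, s x <= f x) ->
    is_cond_exp mu A (EFin \o s) (EFin \o (fun x => fine (cond_exp mu A (EFin \o s) x))).
  move=> ms s0 sf.
  have ms' : measurable_fun [set: T] (EFin \o s) by exact/measurable_EFinP.
  have mf' : measurable_fun [set: T] (EFin \o f) by exact/measurable_EFinP.
  apply: is_cond_exp_fine => //.
  have := is_cond_exp_le ms' mf' s0 sf (cond_expP ms' s0) (cond_expP mf' f0).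
  by apply: filterS2 foo => x foo /le_lt_trans; apply.
exists (fun x => Num.max (w x) 0), (fun x => Num.max (- w x) 0).
exists (fun x => fine (cond_exp mu A (fun y => (Num.max (w y) 0)%:E) x)).
exists (fun x => fine (cond_exp mu A (fun y => (Num.max (- w y) 0)%:E) x)).
have mp : measurable_fun [set: T] (fun x => Num.max (w x) 0) by exact: measurable_maxr.
have mn : measurable_fun [set: T] (fun x => Num.max (- w x) 0).
  by apply: measurable_maxr => //; exact: measurableT_comp.
split => //.
- by split => x; rewrite le_max lexx orbT.
- split; apply: fin => // x; rewrite ?le_max ?lexx ?orbT//.
    by rewrite ge_max f0 (le_trans (ler_norm _)).
  by rewrite ge_max f0 (le_trans (ler_norm _))//= normrN.
- move=> x; split => //; have [h0|h0] := leP 0 (w x).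
    by rewrite max_r ?subr0// oppr_le0.
  by rewrite max_l ?oppr_ge0 ?ltW// sub0r opprK.
Qed.

(** * Conditional expectation of complex functions *)

Definition Ameasurable_complex (g : T -> R[i]) :=
  measurable_complex (g : TA -> R[i]).

Lemma Ameasurable_complex_measurable g :
  Ameasurable_complex g -> measurable_complex g.
Proof.
by move=> [mRe mIm]; split; apply: Ameasurable_measurable.
Qed.

Lemma Ameasurable_cond_exp_real (w : T -> R) : measurable_fun [set: T] w ->
  Ameasurable (cond_exp_real mu A w).
Proof.
move=> mw; have meas (s : T -> R) : measurable_fun [set: T] s ->
    Ameasurable (fun x => fine (cond_exp mu A (fun y => (Num.max (s y) 0)%:E) x)).
  move=> ms; apply: measurableT_comp => //.
  have ms' : measurable_fun [set: T] (fun y => (Num.max (s y) 0)%:E).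
    by apply/measurable_EFinP/measurable_maxr.
  have s0 y : (0 <= (Num.max (s y) 0)%:E)%E by rewrite lee_fin le_max lexx orbT.
  by have [] := cond_expP ms' s0.
apply: measurable_funB; first exact: meas.
by apply: (meas (\- w)); exact: measurableT_comp.
Qed.

Lemma Ameasurable_cond_expC f : measurable_complex f ->
  Ameasurable_complex (cond_expC mu A f).
Proof. by move=> [mRe mIm]; split; exact: Ameasurable_cond_exp_real. Qed.

Variable v : T -> R[i].
Hypothesis v_cond : conditionable mu A v.

Lemma has_cond_exp_ReIm :
  has_cond_exp (fun x => complex.Re (v x))
    (fun x => complex.Re (cond_expC mu A v x)) /\
  has_cond_exp (fun x => complex.Im (v x))
    (fun x => complex.Im (cond_expC mu A v x)).
Proof.
have [[mRe mIm] voo] := v_cond; have mv := measurable_modc v_cond.1.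
split.
  apply: (has_cond_exp_real mRe mv _ voo) => x.
  exact: ler_Re_modc.
apply: (has_cond_exp_real mIm mv _ voo) => x.
exact: ler_Im_modc.
Qed.

Lemma cond_expC_mul g : Ameasurable_complex g ->
  {ae mu, forall x, cond_expC mu A (fun y => v y * g y) x = cond_expC mu A v x * g x}.
Proof.
move=> mg; have [mv _] := v_cond; have [mgr mgi] := mg.
have [hRe hIm] := has_cond_exp_ReIm.
have [mRe mIm] := measurable_complexM mv (Ameasurable_complex_measurable mg).
have hM := has_cond_expM.
have HRe : has_cond_exp (fun x => complex.Re (v x * g x))
    (fun x => complex.Re (cond_expC mu A v x * g x)).
  have := has_cond_exp_add (hM _ _ _ mgr hRe)
    (has_cond_exp_opp (hM _ _ _ mgi hIm)).
  by congr has_cond_exp; apply/funext => x; rewrite ReM /=; ring.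
have HIm : has_cond_exp (fun x => complex.Im (v x * g x))
    (fun x => complex.Im (cond_expC mu A v x * g x)).
  have := has_cond_exp_add (hM _ _ _ mgi hRe)
    (hM _ _ _ mgr hIm).
  by congr has_cond_exp; apply/funext => x; rewrite ImM /=; ring.
have := has_cond_expE mIm HIm.
have := has_cond_expE mRe HRe.
apply: filterS2 => x ReE ImE; rewrite {1}/cond_expC ReE ImE.
by case: (cond_expC mu A v x * g x).
Qed.

(** [E |v g| = |g| * E |v|], which is finite almost everywhere. *)
Lemma conditionable_mul g : Ameasurable_complex g ->
  conditionable mu A (fun y => v y * g y).
Proof.
move=> mg; have [mv voo] := v_cond; have mgT := Ameasurable_complex_measurable mg.
split; first exact: measurable_complexM.
have mmv := measurable_modc mv; have mmg := measurable_modc mg.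
have mv' : measurable_fun [set: T] (fun x => (modc (v x))%:E) by exact/measurable_EFinP.
have v0 x : (0 <= (modc (v x))%:E)%E by rewrite lee_fin modc_ge0.
have h1 := is_cond_exp_fine mv' v0 voo.
have h2 := is_cond_expM mmg (fun x => modc_ge0 (g x)) mmv v0 h1.
have mvg : measurable_fun [set: T] (fun y => (modc (v y * g y))%:E).
  by apply/measurable_EFinP/measurable_modc/measurable_complexM.
have vg0 y : (0 <= (modc (v y * g y))%:E)%E by rewrite lee_fin modc_ge0.
have h3 := cond_expP mvg vg0.
rewrite [X in is_cond_exp _ _ X](_ : _ =
  fun x => (modc (g x) * modc (v x))%:E) in h3; last first.
  by apply/funext => x; rewrite modcM mulrC.
have := is_cond_exp_unique h3 h2.
by apply: filterS => x ->; rewrite ltry.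
Qed.

(** * The operator and its iterates *)

Local Notation S := (EMop mu A v).
Local Notation Ev := (cond_expC mu A v).

Lemma Ameasurable_op_fun f : measurable_complex f ->
  Ameasurable_complex (op_fun S f).
Proof.
move=> mf; apply: Ameasurable_cond_expC => //.
by apply: measurable_complexM => //; case: v_cond.
Qed.

Lemma iter_EMop g i : Ameasurable_complex g ->
  Ameasurable_complex (iter i (op_fun S) g) /\
  {ae mu, forall x, iter i (op_fun S) g x = Ev x ^+ i * g x}.
Proof.
move=> mg; elim: i => [|i [mi IH]] /=.
  by split => //; apply: aeW => x; rewrite mul1r.
split; first exact/Ameasurable_op_fun/Ameasurable_complex_measurable.
have := cond_expC_mul mi.
by apply: filterS2 IH => x IH ->; rewrite IH exprS mulrA.
Qed.

Lemma modc_iter_EMop g i : Ameasurable_complex g ->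
  {ae mu, forall x, modc (iter i (op_fun S) g x) ^+ 2 =
                    (modc (Ev x) ^+ 2) ^+ i * modc (g x) ^+ 2}.
Proof.
move=> mg; have [_] := iter_EMop i mg; apply: filterS => x ->.
by rewrite modcM modcX exprMn exprAC.
Qed.

Let Ameas_Ev : Ameasurable_complex Ev.
Proof. by apply: Ameasurable_cond_expC => //; case: v_cond. Qed.

Let absEv x := modc (Ev x).
Let absEv2 x := absEv x ^+ 2.

Let Ameas_absEv : Ameasurable absEv.
Proof. exact: measurable_modc. Qed.

Let Ameas_absEv2 : Ameasurable absEv2.
Proof. exact: measurable_funX. Qed.

Lemma op_dom_L2 f : op_dom S f -> L2 mu f. Proof. by case. Qed.

(** Under the last hypothesis, the integrand [E (|f|^2) + |E (v f)|^2 * A1 n (|E v|^2)] of [Theta] equals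
    [E (|f|^2) * (1 + E (|v|^2) * A1 n (|E v|^2))] where [E (|v|^2)] is finite
    and vanishes where it is infinite. *)
Lemma Theta_EMop_le0 n : (1 <= n)%N ->
  {ae mu, forall x,
    (1 + cond_exp_sqmod mu A v x * (A1 n (absEv2 x))%:E <= 0)%E} ->
  forall f, op_dom_pow mu S n f ->
  {ae mu, forall x, ((modc (op_fun S f x) ^+ 2)%:E =
    cond_exp_sqmod mu A v x * cond_exp_sqmod mu A f x)%E} ->
  Theta mu S n f <= 0.
Proof.
move=> n1 condA1 f fn condCS; have fL2 i := @op_dom_pow_L2 _ _ _ mu S n f i fn op_dom_L2.
have L2f : L2 mu f := fL2 0%N isT.
have [mf foo] := L2f.
have mf2 := measurable_modc_sqr mf.
have f20 x : (0 <= (modc (f x) ^+ 2)%:E)%E by rewrite lee_fin sqr_ge0.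
have AT : A [set: T].
  by case: A_sigma => A0 AC _; have := AC _ A0; rewrite setD0.
have [mEf Ef0 EfE] := cond_expP mf2 f20.
have mEfT := Ameasurable_measurable mEf.
have intEf : mu.-integrable [set: T] (cond_exp_sqmod mu A f).
  apply/integrableP; split; first exact: mEfT.
  by under eq_integral do rewrite (gee0_abs (Ef0 _)); rewrite -EfE.
have Ef_fin := integrable_ae measurableT intEf.
(* [|f|^2] is replaced by its conditional expectation, and [S^(j+1) f] by
   [(E v)^j * S f], since [S f] is [A]-measurable. *)
pose u i x : R := if i is j.+1 then absEv2 x ^+ j * modc (op_fun S f x) ^+ 2
                  else fine (cond_exp_sqmod mu A f x).
have mSf := Ameasurable_op_fun mf.
have m_u i : measurable_fun [set: T] (u i).
  case: i => [|i] /=; first exact: measurableT_comp.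
  apply: measurable_funM.
    exact/measurable_funX/Ameasurable_measurable.
  exact/measurable_funX/measurable_modc/Ameasurable_complex_measurable.
have uE i : (i <= n)%N -> (\int[mu]_x (modc (iter i (op_fun S) f x) ^+ 2)%:E =
                           \int[mu]_x (u i x)%:E)%E.
  move=> le_in; case: i le_in => [|i] le_in.
    rewrite EfE//; apply: ae_eq_integral => //; first exact/measurable_EFinP.
    by apply: filterS Ef_fin => x + _ => /(_ I) Ef; rewrite /u fineK.
  apply: ae_eq_integral => //.
  - by apply: measurable_modc_sqr; case: (fL2 _ le_in).
  - exact/measurable_EFinP.
  - have := modc_iter_EMop i mSf; apply: filterS => x + _.
    by rewrite -iterSr => ->.
have intu i : (i <= n)%N -> mu.-integrable [set: T] (EFin \o u i).
  move=> le_in; apply/integrableP; split; first exact/measurable_EFinP.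
  have u0 x : 0 <= u i x.
    case: (i) => [|j]; first exact: (fine_ge0 (Ef0 x)).
    by apply: mulr_ge0; rewrite ?sqr_ge0// exprn_ge0// sqr_ge0.
  under eq_integral do rewrite /= ger0_norm//.
  by rewrite -uE//; have [] := fL2 _ le_in.
rewrite -lee_fin (Theta_integral intu uE); apply: integral_le0_ae.
  apply/measurable_EFinP; apply: measurable_sum => i.
  by apply: measurable_funM => //; exact: measurable_cst.
apply: filterS3 condA1 condCS Ef_fin => x cA cS /(_ I) Efx.
rewrite lee_fin big_nat_recl//= expr0 bin0 mul1r mul1r.
rewrite (_ : \sum_(0 <= i < n) _ = A1 n (absEv2 x) * modc (op_fun S f x) ^+ 2); last first.
  rewrite /A1 big_add1 /= mulr_suml; apply: eq_bigr => i _.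
  by rewrite /= mulrA.
move: cA cS; rewrite -(fineK Efx).
have Ev0 : (0 <= cond_exp_sqmod mu A v x)%E.
  have mv2 := measurable_modc_sqr v_cond.1.
  have v20 y : (0 <= (modc (v y) ^+ 2)%:E)%E by rewrite lee_fin sqr_ge0.
  by have [_ Ev0 _] := cond_expP mv2 v20; exact: Ev0.
have : 0 <= fine (cond_exp_sqmod mu A f x) by exact: (fine_ge0 (Ef0 x)).
move: (fine _) Ev0 => a; case: (cond_exp_sqmod mu A v x) => [b|_ a0 _|]//.
- rewrite lee_fin => b0 a0; rewrite -EFinM -EFinD lee_fin => cA [->].
  rewrite (_ : a + _ = a * (1 + b * A1 n (absEv2 x))); last by ring.
  exact: mulr_ge0_le0.
(* Where [E (|v|^2)] is infinite, finiteness of [|E (v f)|] forces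
   [E (|f|^2) = 0]. *)
- move: a0; rewrite le_eqVlt => /predU1P[<-|a0].
    by rewrite mule0 => -[->]; rewrite mulr0 addr0.
  by rewrite gt0_mulye.
Qed.

(** The test functions are the indicators of the sets [B m] below, which exhaust
    the set where [A0 n (|E v|^2)] is positive. *)
Lemma hyperexpansive_A0 n : (forall f, op_dom_pow mu S n f -> Theta mu S n f <= 0) ->
  {ae mu, forall x, A0 n (absEv2 x) <= 0}.
Proof.
move=> hyp.
have [F [AF Foo ndF FT]] := sigma_finite_nondecreasing.
have mA0 : Ameasurable (fun x => A0 n (absEv2 x)).
  apply: measurable_sum => i; apply: measurable_funM; first exact: measurable_cst.
  exact: measurable_funX.
pose B m := F m `&` ([set x | absEv2 x <= m%:R] `&` [set x | 0 < A0 n (absEv2 x)]).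
have AB m : A (B m).
  rewrite -measurable_subalgebraE; apply: measurableI.
    by rewrite measurable_subalgebraE.
  apply: measurableI; rewrite -[X in measurable X]setTI.
    by apply: (@measurable_fun_le _ TA R setT absEv2 (cst m%:R)).
  apply: (@measurable_lte _ TA R setT measurableT (cst 0%E)
    (fun x => (A0 n (absEv2 x))%:E)) => //.
  exact/measurable_EFinP.
have mB m : measurable (B m) by exact: A_sub.
suff B0 m : mu (B m) = 0%E.
  have : mu.-negligible (\bigcup_m B m).
    by apply: negligible_bigcup => m; exists (B m); split.
  apply: negligibleS => x /= /negP; rewrite -ltNge => A0x.
  have [N _ FNx] : (\bigcup_n F n) x by rewrite FT.
  near \oo => m; exists m => //; split.
    have Nm : (N <= m)%N by near: m; exact: nbhs_infty_ge.
    by have /subsetPset := ndF _ _ Nm; exact.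
  by split => //=; near: m; exact: nbhs_infty_ger.
have muBoo : (mu (B m) < +oo)%E.
  apply: le_lt_trans (Foo m); apply: le_measure; rewrite ?inE//; last exact: subIsetl.
  exact: A_sub.
pose f x : R[i] := (\1_(B m) x)%:C%C.
have mf : Ameasurable_complex f.
  split; last exact: measurable_cst.
  by apply: (@measurable_indic _ TA); rewrite measurable_subalgebraE.
have modf x : modc (f x) ^+ 2 = \1_(B m) x.
  by rewrite modc_sqrE /= expr0n addr0 indicE; case: (_ \in _); rewrite ?expr1n ?expr0n.
pose u i x := absEv2 x ^+ i * \1_(B m) x.
have u0 i x : 0 <= u i x by rewrite mulr_ge0// exprn_ge0// sqr_ge0.
have m_u i : measurable_fun [set: T] (EFin \o u i).
  apply/measurable_EFinP; apply: measurable_funM; last exact: measurable_indic.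
  exact/measurable_funX/Ameasurable_measurable.
have uoo i : (\int[mu]_x (u i x)%:E < +oo)%E.
  rewrite (_ : \int[mu]_x _ = \int[mu]_(x in B m) (absEv2 x ^+ i)%:E)%E; last first.
    rewrite [RHS]integral_mkcond; apply: eq_integral => x _.
    by rewrite epatch_indic /= EFinM.
  apply: (@le_lt_trans _ _ (\int[mu]_(x in B m) cst ((m%:R ^+ i : R)%:E) x)%E).
    apply: ge0_le_integral => //.
    - by move=> x _; rewrite lee_fin exprn_ge0// sqr_ge0.
    - apply/measurable_EFinP/measurable_funTS/measurable_funX.
      exact: Ameasurable_measurable.
    - by move=> x [_ [/= le_m _]]; rewrite lee_fin lerXn2r ?nnegrE ?sqr_ge0.
  by rewrite integral_cst// lte_mul_pinfty// lee_fin exprn_ge0.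
have iterE i : (\int[mu]_x (modc (iter i (op_fun S) f x) ^+ 2)%:E =
                \int[mu]_x (u i x)%:E)%E.
  have [mi _] := iter_EMop i mf.
  apply: ae_eq_integral => //.
  - exact/measurable_modc_sqr/Ameasurable_complex_measurable.
  - exact: m_u.
  have := modc_iter_EMop i mf; apply: filterS => x + _ => ->.
  by rewrite modf.
have L2i i : L2 mu (iter i (op_fun S) f).
  have [mi _] := iter_EMop i mf.
  by split; [exact: Ameasurable_complex_measurable | rewrite iterE].
have dom_pow p i : op_dom_pow mu S p (iter i (op_fun S) f).
  elim: p i => [|p IH] i //=; split; last exact: (IH i.+1).
  split => //; last exact: (L2i i.+1).
  by apply: conditionable_mul => //; have [] := iter_EMop i mf.
have intu i : (i <= n)%N -> mu.-integrable [set: T] (EFin \o u i).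
  move=> _; apply/integrableP; split => //.
  by under eq_integral do rewrite /= ger0_norm//.
have := hyp f (dom_pow n 0%N).
rewrite -lee_fin (Theta_integral intu (fun i _ => iterE i)).
pose G x : \bar R := (A0 n (absEv2 x) * \1_(B m) x)%:E.
have mG : measurable_fun [set: T] G.
  apply/measurable_EFinP; apply: measurable_funM; last exact: measurable_indic.
  exact: Ameasurable_measurable.
rewrite (_ : \int[mu]_x _ = \int[mu]_x G x)%E; last first.
  apply: eq_integral => x _; congr EFin; rewrite /A0 mulr_suml.
  by apply: eq_bigr => i _; rewrite mulrA.
have G0 x : (0 <= G x)%E.
  rewrite /G lee_fin indicE; case: (boolP (x \in B m)) => xB; last by rewrite mulr0.
  by move: xB; rewrite inE mulr1 => -[_ [_ /ltW]].
move=> intG0.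
have intabs : (\int[mu]_x `|G x| = 0)%E.
  under eq_integral do rewrite gee0_abs//.
  by apply/eqP; rewrite eq_le intG0 integral_ge0.
have /(ae_eq_integral_abs mu measurableT mG) Gae := intabs.
apply/negligibleP => //; apply: negligibleS Gae => x Bx /= /(_ I).
rewrite /G indicE mem_set// mulr1 => -[A0x].
by case: Bx => _ [_ /=]; rewrite A0x ltxx.
Unshelve. all: by end_near. Qed.

End subalgebra.

Theorem mainTheorem9 (d : measure_display) (T : measurableType d)
    (R : realType) (mu : {measure set T -> \bar R})
    (mu_sfinite : sigma_finite [set: T] mu)
    (A : set (set T))
    (A_sigma : sigma_algebra [set: T] A)
    (A_sub : forall B, A B -> measurable B)
    (muA_sfinite : sigma_finite [set: g_sigma_algebraType A] mu)
    (v : T -> R[i]) (v_cond : conditionable mu A v)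
    (v_dense : dense_in_L2 mu (op_dom (EMop mu A v)))
    (k : nat) (k_ge1 : (1 <= k)%N) :
  let S := EMop mu A v in
  let absEv := fun x => modc (cond_expC mu A v x) in
  let absEv2 := fun x => absEv x ^+ 2 in
  let Esq := cond_exp_sqmod mu A in
  let condA1 := fun n =>
    {ae mu, forall x, (1 + Esq v x * (A1 n (absEv2 x))%:E <= 0)%E} in
  let condCS := fun n =>
    forall f, op_dom_pow mu S n f ->
      {ae mu, forall x, ((modc (op_fun S f x) ^+ 2)%:E = Esq v x * Esq f x)%E} in
  [/\ k_hyperexpansive mu k S ->
        forall n, (1 <= n <= k)%N -> {ae mu, forall x, A0 n (absEv2 x) <= 0},
      (forall n, (1 <= n <= k)%N -> condA1 n /\ condCS n) ->
        k_hyperexpansive mu k S,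
      completely_hyperexpansive mu S ->
        {ae mu, forall x, completely_alternating (fun n => absEv x ^+ (2 * n))} /\
        (forall n, (1 <= n)%N -> {ae mu, forall x, A0 n (absEv2 x) <= 0}) &
      (forall n, (1 <= n)%N -> condA1 n /\ condCS n) ->
        completely_hyperexpansive mu S].
Proof.
move=> S absEv absEv2 Esq condA1 condCS.
have A0_le0 n : (forall f, op_dom_pow mu S n f -> Theta mu S n f <= 0) ->
    {ae mu, forall x, A0 n (absEv2 x) <= 0}.
  exact: hyperexpansive_A0.
have Theta_le0 n : (1 <= n)%N -> condA1 n /\ condCS n ->
    forall f, op_dom_pow mu S n f -> Theta mu S n f <= 0.
  by move=> n1 [cA cCS] f fn; exact: (Theta_EMop_le0 _ _ _ _ n1 cA fn (cCS f fn)).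
split.
- by move=> hyp n n1k; apply: A0_le0 => f; exact: hyp.
- by move=> cond n n1k; apply: Theta_le0 (cond n n1k); case/andP: n1k.
- move=> hyp.
  have A0_all n : (1 <= n)%N -> {ae mu, forall x, A0 n (absEv2 x) <= 0}.
    by move=> n1; apply: A0_le0 => f; exact: hyp.
  split=> //.
  have : {ae mu, forall x, forall n, A0 n.+1 (absEv2 x) <= 0}.
    by apply: ae_foralln => n; exact: A0_all.
  apply: filterS => x A0x; apply: completely_alternating_powers.
    exact: modc_ge0.
  by case=> // n _; exact: A0x.
- by move=> cond n n1; apply: Theta_le0 (cond n n1).
Qed.
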